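(* Let $0 < \nu < 1$, $\lambda \in \mathbb{R}$ with $|\lambda| < 1$, and $m \in \mathbb{N}_1$. Let $$\hat{e}_{\nu}(\lambda, t^{\overline{\nu}}) = \sum_{k=0}^{\infty} \lambda^k H_{\nu k}(t, 0).$$ Let $\mathcal{L} = [\mathcal{L}_{ij}]$ be the $m \times m$ lower triangular matrix with $$\mathcal{L}_{ij} = \begin{cases} 1 - \lambda, & i = j, \\ 0, & i < j, \\ H_{-\nu-1}(i, \rho(j)), & i > j, \end{cases}$$ and let $\mathcal{C} \in \mathbb{R}^m$ be the column vector with entries $\mathcal{C}_i = H_{-\nu}(i, 0)$, $1 \le i \le m$. Then $\mathcal{L}$ is non-singular and $$\big[\hat{e}_{\nu}(\lambda, 1^{\overline{\nu}}), \hat{e}_{\nu}(\lambda, 2^{\overline{\nu}}), \ldots, \hat{e}_{\nu}(\lambda, m^{\overline{\nu}})\big]^T = \mathcal{L}^{-1}\mathcal{C}.$$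
   Context: For $a \in \mathbb{R}$, $\mathbb{N}_a = \{a, a+1, a+2, \ldots\}$. The backward jump operator is $\rho(t) = t - 1$. Nabla fractional Taylor monomials: for $\mu \in \mathbb{R} \setminus \{\ldots, -2, -1\}$, $$H_\mu(t,a) = \frac{\Gamma(t-a+\mu)}{\Gamma(t-a)\,\Gamma(\mu+1)}$$ whenever the right-hand side is sensible, where $\Gamma$ is the Euler gamma function. The function $t \mapsto \hat{e}_\nu(\lambda, t^{\overline{\nu}})$ on $\mathbb{N}_0$ (where $t^{\overline{\nu}}$ is only part of the notation) is the exponential function of nabla fractional calculus introduced as the unique solution of the initial value problem $(\nabla^{\nu}_{0*}x)(t) = \lambda x(t)$ for $t \in \mathbb{N}_1$, $x(0) = 1$. Here, for $u : \mathbb{N}_a \to \mathbb{R}$ and $0 < \nu < 1$, the Caputo nabla fractional difference based at $a$ is $$(\nabla^{\nu}_{a*}u)(t) = \big(\nabla_a^{-(1-\nu)}(\nabla u)\big)(t), \quad t \in \mathbb{N}_{a+1},$$ with $(\nabla u)(t) = u(t) - u(t-1)$ and, for $v : \mathbb{N}_{a+1} \to \mathbb{R}$ and $\alpha > 0$, $(\nabla_a^{-\alpha} v)(t) = \sum_{s=a+1}^{t} H_{\alpha-1}(t,\rho(s))\,v(s)$. *)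

(* Defs.v *)
From HB Require Import structures.
From mathcomp Require Import all_boot all_order all_algebra.
From mathcomp Require Import all_classical all_reals all_analysis.
Set Implicit Arguments.
Unset Strict Implicit.
Unset Printing Implicit Defensive.
Import Order.TTheory GRing.Theory Num.Theory numFieldNormedType.Exports.
Local Open Scope classical_set_scope.
Local Open Scope ring_scope.

(* Euler's integral, meant for x > 0. *)
Definition euler_integral (R : realType) (x : R) : R :=
  \int[lebesgue_measure]_(t in `]0, +oo[) (t `^ (x - 1) * expR (- t)).

(* Gamma x = Gamma (x + n) / (x (x + 1) ... (x + n - 1)), where n is the least
   natural number such that 0 < x + n; in particular n = 0 when 0 < x.
   At the poles 0, -1, -2, ... the product vanishes and the value is 0. *)
Definition Gamma (R : realType) (x : R) : R :=
  let n := Num.truncn (1 - x) in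
  euler_integral (x + n%:R) / \prod_(i < n) (x + i%:R).

Definition rho (R : realType) (t : R) : R := t - 1.

(* The Taylor monomial H_mu(t, a). *)
Definition taylor_monomial (R : realType) (mu t a : R) : R :=
  Gamma (t - a + mu) / (Gamma (t - a) * Gamma (mu + 1)).

(* Functions on N_0 are functions on nat; the fractional operators below are
   those based at a = 0. *)
Definition nabla (R : realType) (u : nat -> R) (t : nat) : R :=
  u t - u t.-1.

(* The order -alpha nabla fractional sum at t; only v 1, ..., v t occur. *)
Definition nabla_sum (R : realType) (alpha : R) (v : nat -> R) (t : nat) : R :=
  \sum_(1 <= s < t.+1) taylor_monomial (alpha - 1) t%:R (rho s%:R) * v s.

Definition caputo (R : realType) (nu : R) (u : nat -> R) : nat -> R :=
  nabla_sum (1 - nu) (nabla u).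

Definition caputo_ivp (R : realType) (nu lambda : R) (x : nat -> R) : Prop :=
  (forall t, (1 <= t)%N -> caputo nu x t = lambda * x t) /\ x 0%N = 1.

Definition nabla_exp_term (R : realType) (nu lambda : R) (t k : nat) : R :=
  lambda ^+ k * taylor_monomial (nu * k%:R) t%:R 0.

(* At t = 0 the quotients of Gamma values defining H_(nu k)(0, 0) are not
   sensible (Gamma has a pole at 0), so the initial value is prescribed. *)
Definition nabla_exp (R : realType) (nu lambda : R) (t : nat) : R :=
  if t == 0%N then 1 else limn (series (nabla_exp_term nu lambda t)).

(* Rows and columns are numbered from 0: the entry (i, j) below is the entry
   (i + 1, j + 1) of the usual numbering. *)
Definition matL (R : realType) (nu lambda : R) (m : nat) : 'M[R]_m :=
  \matrix_(i < m, j < m)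
    if i == j then 1 - lambda
    else if (i < j)%N then 0
    else taylor_monomial (- nu - 1) i.+1%:R (rho j.+1%:R).

Definition vecC (R : realType) (nu : R) (m : nat) : 'cV[R]_m :=
  \col_(i < m) taylor_monomial (- nu) i.+1%:R 0.

(* Main.v *)
Require Import Defs.
From HB Require Import structures.
From mathcomp Require Import all_boot all_order all_algebra.
From mathcomp Require Import all_classical all_reals all_analysis.
From mathcomp Require Import measurable_realfun.
From mathcomp Require Import ring lra.
Import Order.TTheory GRing.Theory Num.Theory numFieldNormedType.Exports.
Local Open Scope classical_set_scope.
Local Open Scope ring_scope.

(* By Gamma (x + 1) = x * Gamma x, each Taylor monomial H_mu(n + 1, 0) is the
   coefficient of z^n in (1 - z)^-(mu + 1), written [rising_coef (mu + 1) n].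
   Multiplying these generating functions gives a Vandermonde identity, by
   which the Caputo difference of order nu sends H_(nu (k + 1)) to H_(nu k);
   applied termwise, it multiplies the exponential series by lambda. Summing
   by parts turns row n of the initial value problem into row n of the
   triangular system L x = C, whose diagonal entries 1 - lambda are nonzero. *)

(** * Coefficients of [(1 - z)^-a] *)

Definition rising_coef {R : fieldType} (a : R) (n : nat) : R :=
  \prod_(i < n) ((a + i%:R) / i.+1%:R).

Lemma rising_coef0 (R : fieldType) (a : R) : rising_coef a 0 = 1.
Proof. by rewrite /rising_coef big_ord0. Qed.

Lemma rising_coefS (R : fieldType) (a : R) (n : nat) :
  rising_coef a n.+1 = rising_coef a n * ((a + n%:R) / n.+1%:R).
Proof. by rewrite /rising_coef big_ord_recr. Qed.

Section rising_coef_num.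
Context {R : numFieldType}.
Implicit Types (a b : R) (n : nat).

Lemma rising_coefS_mul a n :
  n.+1%:R * rising_coef a n.+1 = (a + n%:R) * rising_coef a n.
Proof. by rewrite rising_coefS; field; rewrite addrC natr1 pnatr_eq0. Qed.

(** Differentiate [(1 - z)^-(a - 1)] and compare the coefficients of [z^n]. *)
Lemma rising_coef_pred a n :
  n.+1%:R * rising_coef (a - 1) n.+1 = (a - 1) * rising_coef a n.
Proof.
elim: n => [|n IHn]; first by rewrite rising_coefS_mul !rising_coef0 addr0.
have n0 : n.+1%:R != 0 :> R by rewrite pnatr_eq0.
apply: (mulfI n0); rewrite rising_coefS_mul mulrCA IHn.
rewrite [RHS]mulrCA rising_coefS_mul -natr1; ring.
Qed.

(** Multiplying [(1 - z)^-a] by [1 - z] is taking the backward difference in [n]; it lowers the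
    parameter by one. *)
Lemma rising_coef_pascal a n :
  rising_coef a n.+1 = rising_coef (a - 1) n.+1 + rising_coef a n.
Proof.
have n0 : n.+1%:R != 0 :> R by rewrite pnatr_eq0.
apply: (mulfI n0).
by rewrite mulrDr rising_coefS_mul rising_coef_pred -natr1; ring.
Qed.

(* Both sides satisfy (n + 1) c_(n+1) = (a + b + n) c_n. *)
Lemma rising_coef_vandermonde a b n :
  \sum_(i < n.+1) rising_coef a i * rising_coef b (n - i) =
  rising_coef (a + b) n.
Proof.
elim: n => [|n IHn]; first by rewrite big_ord1 !rising_coef0 mulr1.
have n0 m : m.+1%:R != 0 :> R by rewrite pnatr_eq0.
apply: (mulfI (n0 n)); rewrite rising_coefS_mul -IHn mulr_sumr.
(* As in the product rule, the weight [n + 1] is split as [i + (n + 1 - i)], so that each factor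
   meets its own recurrence. *)
transitivity (\sum_(i < n.+2) (i%:R * rising_coef a i * rising_coef b (n.+1 - i)
   + rising_coef a i * ((n.+1 - i)%:R * rising_coef b (n.+1 - i)))).
  apply: eq_bigr => i _.
  have -> : n.+1%:R = i%:R + (n.+1 - i)%:R :> R.
    by rewrite -natrD subnKC// -ltnS.
  ring.
(* One end term of each sum vanishes; after reindexing, the weights add up to
   [(a + i) + (b + n - i) = a + b + n]. *)
rewrite big_split/= big_ord_recl/= mul0r mul0r add0r.
rewrite [X in _ + X]big_ord_recr/= subnn mul0r mulr0 addr0 -big_split/= mulr_sumr.
apply: eq_bigr => i _.
have i_le : (i <= n)%N by rewrite -ltnS.
rewrite /bump/= add1n rising_coefS_mul subSS subSn// rising_coefS_mul.
have -> : n%:R = i%:R + (n - i)%:R :> R by rewrite -natrD subnKC.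
ring.
Qed.

Lemma rising_coef_at1 n : rising_coef 1 n = 1 :> R.
Proof.
by rewrite /rising_coef big1// => i _; rewrite addrC natr1 divff// pnatr_eq0.
Qed.

Lemma rising_coef_at0 n : rising_coef 0 n.+1 = 0 :> R.
Proof. by rewrite /rising_coef big_ord_recl/= addr0 mul0r mul0r. Qed.

Lemma rising_coef_ge0 a n : 0 <= a -> 0 <= rising_coef a n.
Proof.
by move=> a0; apply: prodr_ge0 => i _; rewrite divr_ge0// addr_ge0.
Qed.

Lemma le_rising_coef a b n : 0 <= a -> a <= b ->
  rising_coef a n <= rising_coef b n.
Proof.
move=> a0 ab; apply: ler_prod => i _; apply/andP; split.
  by rewrite divr_ge0// addr_ge0.
by rewrite ler_wpM2r// lerD2r.
Qed.

End rising_coef_num.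

(** * Convergence of the exponential series *)

Section negative_binomial_series.
Context {R : realType}.

(** [rising_coef (k + 1) n] is the binomial coefficient [C(n + k, k)], and the bound is the sum of
    the full series. *)
Lemma rising_coef_series_le (r : R) (n N : nat) : 0 <= r -> r < 1 ->
  \sum_(k < N) r ^+ k * rising_coef k.+1%:R n <= (1 - r)^-1 ^+ n.+1.
Proof.
move=> r0 r1; have r1' : 0 < 1 - r by rewrite subr_gt0.
elim: n N => [|n IHn] N.
  under eq_bigr do rewrite rising_coef0 mulr1.
  elim: N => [|N IHN]; first by rewrite big_ord0 invr_ge0 ltW.
  rewrite big_ord_recl/=.
  under eq_bigr do rewrite /bump/= add1n exprS.
  rewrite -mulr_sumr expr0 expr1 in IHN *.
  rewrite (le_trans (lerD (lexx _) (ler_wpM2l r0 IHN)))//.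
  have -> : 1 + r / (1 - r) = (1 - r)^-1 by field; rewrite gt_eqF.
  exact: lexx.
elim: N => [|N IHN]; first by rewrite big_ord0 exprn_ge0// invr_ge0 ltW.
(* Pascal's rule gives this recursion; with [B] the bound at [n], the bound at [n + 1] is the fixed
   point of [X = r X + B]. *)
have -> : \sum_(k < N.+1) r ^+ k * rising_coef k.+1%:R n.+1 =
  r * (\sum_(k < N) r ^+ k * rising_coef k.+1%:R n.+1)
  + \sum_(k < N.+1) r ^+ k * rising_coef k.+1%:R n.
  under eq_bigr => k _.
    rewrite rising_coef_pascal -[in X in X - 1]natr1 addrK mulrDr.
    over.
  rewrite big_split/= big_ord_recl/= rising_coef_at0 mulr0 add0r mulr_sumr.
  by congr +%R; apply: eq_bigr => i _; rewrite /bump/= add1n exprS mulrA.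
rewrite (le_trans (lerD (ler_wpM2l r0 IHN) (IHn N.+1)))//.
rewrite [_ ^+ n.+2]exprS; set B := _ ^+ n.+1.
have -> : r * ((1 - r)^-1 * B) + B = (1 - r)^-1 * B by field; rewrite gt_eqF.
exact: lexx.
Qed.

(** Since [nu k + 1 <= k + 1], monotonicity in the parameter dominates the absolute values by the
    series just bounded. *)
Lemma is_cvg_rising_coef_series (nu lambda : R) (n : nat) :
  0 <= nu -> nu <= 1 -> `|lambda| < 1 ->
  cvgn (series (fun k => lambda ^+ k * rising_coef (nu * k%:R + 1) n)).
Proof.
move=> nu0 nu1 l1.
have h0 k : 0 <= nu * k%:R + 1 by rewrite addr_ge0// mulr_ge0.
apply: normed_cvg; rewrite /normed_series_of/=.
apply: (@series_le_cvg _ _ (fun k => `|lambda| ^+ k * rising_coef k.+1%:R n)).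
- by move=> k /=.
- by move=> k; rewrite mulr_ge0// ?exprn_ge0// rising_coef_ge0.
- move=> k; rewrite normrM normrX (ger0_norm (rising_coef_ge0 _ _ (h0 k))).
  by rewrite ler_wpM2l ?exprn_ge0// le_rising_coef// -natr1 lerD2r ler_piMl.
apply: nondecreasing_is_cvgn.
  apply: nondecreasing_series => k _ _.
  by rewrite mulr_ge0// ?exprn_ge0// rising_coef_ge0.
exists ((1 - `|lambda|)^-1 ^+ n.+1) => _ [N _ <-].
by rewrite /series/= big_mkord rising_coef_series_le.
Qed.

End negative_binomial_series.

(** * Functional equation, finiteness and positivity of Euler's integral *)

Section euler_integral.
Context {R : realType}.
Local Notation mu := (@lebesgue_measure R).
Implicit Types x t : R.

Let euler_integrand x t := t `^ (x - 1) * expR (- t).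

Let euler_integrand_ge0 x t : 0 <= euler_integrand x t.
Proof. by rewrite mulr_ge0 ?powR_ge0 ?expR_ge0. Qed.

Let measurable_euler_integrand x (D : set R) :
  measurable_fun D (EFin \o euler_integrand x).
Proof.
apply/measurable_EFinP; apply: measurable_funTS; apply: measurable_funM.
  exact: measurable_powR.
exact: measurableT_comp.
Qed.

(** Extended-valued, because the functional equation comes first and finiteness is derived from
    it. *)
Let eint x : \bar R := (\int[mu]_(t in `]0%R, +oo[) (euler_integrand x t)%:E)%E.

(* The integrand may be singular at 0, so limits are taken over compact
   windows exhausting the half line. *)
Let window n : set R := `[n.+1%:R^-1, n.+2%:R].

Let eint_window x n : \bar R :=
  (\int[mu]_(t in window n) (euler_integrand x t)%:E)%E.

Let bigcup_window : \bigcup_n window n = `]0, +oo[%classic.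
Proof.
apply/seteqP; split => [t [n _]|t]; rewrite /window/= !in_itv/= andbT.
  by move=> /andP[+ _]; apply: lt_le_trans; rewrite invr_gt0.
(* The sum serves both ends: [n + 1] exceeds [1 / t] and [n + 2] exceeds [t]. *)
move=> t0; pose n := (Num.truncn t + Num.truncn t^-1)%N.
exists n => //=; rewrite in_itv/=; apply/andP; split.
  rewrite -[t]invrK lef_pV2 ?posrE ?invr_gt0//.
  rewrite (le_trans (ltW (truncnS_gt _)))// ler_nat ltnS leq_addl//.
by rewrite (le_trans (ltW (truncnS_gt _)))// ler_nat ltnS /n leqW// leq_addr.
Qed.

Let cvg_eint_window x : eint_window x n @[n --> \oo] --> eint x.
Proof.
rewrite /eint -bigcup_window; apply: ge0_nondecreasing_set_cvg_integral.
- apply/nondecreasing_seqP => n; rewrite subsetEset => t; rewrite /window/= !in_itv/=.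
  move=> /andP[h1 h2]; apply/andP; split.
    by apply: le_trans h1; rewrite lef_pV2 ?posrE// ler_nat.
  by apply: (le_trans h2); rewrite ler_nat.
- by move=> n; exact: measurable_itv.
- by move=> n; exact: measurable_euler_integrand.
- by move=> n t _; rewrite lee_fin.
Qed.

Let continuous_powR_gt0 (p t : R) : 0 < t -> y `^ p @[y --> t] --> t `^ p.
Proof.
move=> t0; apply: (@differentiable_continuous _ _ _ t (@powR R ^~ p)).
by apply/derivable1_diffP; apply: (@derivable_powR R); rewrite in_itv/= andbT.
Qed.

(* Integration by parts on [window n]; at x = 0 it evaluates [eint_window 1 n]. *)
Let eint_windowS x n :
  eint_window (x + 1) n =
  ((n.+1%:R^-1 `^ x * expR (- n.+1%:R^-1) - n.+2%:R `^ x * expR (- n.+2%:R))%:E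
   + x%:E * eint_window x n)%E.
Proof.
pose a : R := n.+1%:R^-1; pose b : R := n.+2%:R.
have a0 : 0 < a by rewrite invr_gt0.
have ab : a < b.
  rewrite (@le_lt_trans _ _ 1)//; first by rewrite invf_le1// ler1n.
  by rewrite ltr1n.
have b0 : 0 < b by exact: lt_trans ab.
have cwin (f : R -> R) : (forall t, 0 < t -> f y @[y --> t] --> f t) ->
    {within `[a, b], continuous f}.
  move=> cf; apply: continuous_in_subspaceT => t.
  by rewrite inE/= in_itv/= => /andP[at_ _]; apply: cf; exact: lt_le_trans at_.
have cexp : continuous (fun t : R => expR (- t)).
  by move=> t; apply: continuous_comp; [exact: opp_continuous|exact: continuous_expR].
have dexp t : is_derive t 1 (fun t => - expR (- t)) (expR (- t)).
  by apply: is_derive_eq; rewrite mulrN1 opprK.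
have dpow t : 0 < t -> is_derive t 1 (@powR R ^~ x) (x * t `^ (x - 1)).
  exact: is_derive1_powR.
have itv_gt0 t : t \in `]a, b[ -> 0 < t.
  by rewrite in_itv/= => /andP[at_ _]; exact: lt_trans at_.
have := @integration_by_parts R (@powR R ^~ x) (fun t => - expR (- t))
  (fun t => x * t `^ (x - 1)) (fun t => expR (- t)) a b ab.
rewrite /eint_window /window -/a -/b /euler_integrand addrK => ->; last 6 first.
- by apply: cwin => t t0; apply: cvgMl_tmp; exact: continuous_powR_gt0.
- split.
  + by move=> t /itv_gt0/dpow[].
  + by apply: cvg_at_right_filter; exact: continuous_powR_gt0.
  + by apply: cvg_at_left_filter; exact: continuous_powR_gt0.
- by move=> t /itv_gt0/dpow; rewrite derive1E => -[].
- exact: continuous_subspaceT.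
- split.
  + by move=> t _; have [] := dexp t.
  + by apply: cvg_at_right_filter; apply: cvgN; exact: cexp.
  + by apply: cvg_at_left_filter; apply: cvgN; exact: cexp.
- by move=> t _; rewrite derive1E; have [] := dexp t.
under [X in (_ - X)%E]eq_integral do rewrite mulrN -mulrA -mulNr EFinM.
rewrite integralZl//=; last first.
  apply: continuous_compact_integrable; first exact: segment_compact.
  apply: cwin => t t0; apply: cvgM; last exact: cexp.
  exact: continuous_powR_gt0.
by rewrite EFinN mulNe oppeK !mulrN opprK (addrC (- _)).
Qed.

Let cvg_boundary_right x : 0 < x ->
  n.+1%:R^-1 `^ x * expR (- n.+1%:R^-1) @[n --> \oo] --> (0 : R).
Proof.
move=> x0; apply: (@squeeze_cvgr _ _ _ _ (fun=> 0) (fun n => n.+1%:R^-1 `^ x)).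
- near=> n; rewrite mulr_ge0 ?powR_ge0 ?expR_ge0//= ler_piMr ?powR_ge0//.
- exact: cvg_cst.
- have /cvg_at_rightP h := powR_cvg0 x0.
  by apply: (h harmonic); split; [exact: harmonic_gt0|exact: cvg_harmonic].
Unshelve. all: end_near. Qed.

Let cvg_powR_expRN x : t `^ x * expR (- t) @[t --> +oo] --> (0 : R).
Proof.
(* For [t >= 1], [t^x <= t^N], and [exp t >= t^(N + 1) / (N + 1)!] leaves a factor [1 / t]. *)
pose N := (Num.truncn x).+1.
have xN : x <= N%:R by exact/ltW/truncnS_gt.
apply: (@squeeze_cvgr _ _ _ _ (fun=> 0) (fun t => N.+1`!%:R * t^-1)).
- near=> t.
  have t1 : 1 <= t by near: t; exact: nbhs_pinfty_ge.
  have t0 : 0 < t by exact: lt_le_trans t1.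
  rewrite mulr_ge0 ?powR_ge0 ?expR_ge0//= expRN ler_pdivrMr ?expR_gt0//.
  rewrite (le_trans (ler_powR t1 xN))// powR_mulrn ?(ltW t0)//.
  have f0 : 0 < N.+1`!%:R :> R by rewrite ltr0n fact_gt0.
  have h : t ^+ N.+1 <= expR t * N.+1`!%:R.
    by rewrite -ler_pdivrMr// (le_trans _ (expR_ge1Dxn N (ltW t0)))// lerDr.
  rewrite -(ler_pM2l t0) -exprS (le_trans h)//.
  by rewrite mulrAC mulrCA divff ?gt_eqF// mulr1 mulrC.
- exact: cvg_cst.
- rewrite -[X in _ --> X](mulr0 N.+1`!%:R); apply: cvgMl_tmp.
  by apply/gtr0_cvgV0 => //; near=> t; near: t; exact: nbhs_pinfty_gt.
Unshelve. all: end_near. Qed.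

Let cvg_boundary_left x :
  n.+2%:R `^ x * expR (- n.+2%:R) @[n --> \oo] --> (0 : R).
Proof.
have /cvg_pinftyP h := cvg_powR_expRN x.
apply: (h (fun n => n.+2%:R)); under eq_fun do rewrite -addn2.
by have := @cvgr_idn R; rewrite -(cvg_shiftn 2).
Qed.

(** This is the limit of the windowed integration by parts; [0 < x] makes the boundary term at 0
    vanish. *)
Let eintS x : 0 < x -> eint (x + 1) = (x%:E * eint x)%E.
Proof.
move=> x0.
have h1 := cvg_eint_window (x + 1).
have h2 : eint_window (x + 1) n @[n --> \oo] --> (0%:E + x%:E * eint x)%E.
  under eq_fun do rewrite eint_windowS.
  apply: cvgeD; first by rewrite fin_num_adde_defr.
    apply: cvg_EFin; first exact: nearW.
    rewrite -[X in _ --> X]subr0; apply: cvgB; last exact: cvg_boundary_left.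
    exact: cvg_boundary_right.
  by apply: cvgeZl => //; exact: cvg_eint_window.
rewrite -[RHS]add0e; exact: (cvg_unique _ h1 h2).
Qed.

Let eint1 : eint 1 = 1%E.
Proof.
have h1 := cvg_eint_window 1.
have h2 : eint_window 1 n @[n --> \oo] --> 1%:E.
  rewrite -[X in eint_window X]add0r.
  under eq_fun do rewrite eint_windowS mul0e adde0 !powRr0 !mul1r.
  apply: cvg_EFin; first exact: nearW.
  rewrite -[X in _ --> X]subr0 -[X in _ --> X - _]expR0 -[in X in _ --> X - _]oppr0.
  apply: cvgB; last first.
    under eq_fun do rewrite -addn2.
    by have := @cvgn_expR R; rewrite -(cvg_shiftn 2).
  apply: continuous_cvg; first exact: continuous_expR.
  by apply: cvgN; exact: cvg_harmonic.
exact: (cvg_unique _ h1 h2).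
Qed.

Let eint_ge0 x : (0 <= eint x)%E.
Proof. by apply: integral_ge0 => t _; rewrite lee_fin. Qed.

Let eint_nat_fin n : eint n.+1%:R \is a fin_num.
Proof.
elim: n => [|n IHn]; first by rewrite eint1.
by rewrite -natr1 eintS ?ltr0n// fin_numM.
Qed.

(** The power [t^(x - 1)] is at most [t^n] where [t >= 1] and at most [1] elsewhere, so the
    integrals at [n + 1] and [1] dominate. *)
Let eint_fin_ge1 x : 1 <= x -> eint x \is a fin_num.
Proof.
move=> x1; pose n := Num.truncn x.
rewrite ge0_fin_numE//; apply: (@le_lt_trans _ _ (eint 1 + eint n.+1%:R)%E).
  rewrite -ge0_integralD//=; [|by move=> t _; rewrite lee_fin
    |exact: measurable_euler_integrand|by move=> t _; rewrite lee_fin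
    |exact: measurable_euler_integrand].
  apply: ge0_le_integral => //=.
  - by move=> t _; rewrite lee_fin.
  - exact: measurable_euler_integrand.
  - by apply: emeasurable_funD; exact: measurable_euler_integrand.
  - move=> t; rewrite in_itv/= andbT => t0; rewrite -EFinD lee_fin.
    rewrite /euler_integrand subrr powRr0 -mulrDl ler_wpM2r ?expR_ge0//.
    have [t1|t1] := leP 1 t.
      rewrite (@le_trans _ _ (t `^ (n.+1%:R - 1)))// ?lerDr//.
      by rewrite ler_powR// lerD2r ltW// truncnS_gt.
    rewrite (@le_trans _ _ 1)// ?lerDl ?powR_ge0//.
    by rewrite -[leRHS](powRr0 t) ger_powR ?subr_ge0// t0 ltW.
by rewrite lte_add_pinfty// ltey_eq ?eint1 ?eint_nat_fin.
Qed.

(** An infinite value at [x] would force one at [x + 1 >= 1] through the functional equation. *)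
Let eint_fin x : 0 < x -> eint x \is a fin_num.
Proof.
move=> x0; have := @eint_fin_ge1 (x + 1); rewrite lerDr ltW// => /(_ isT).
rewrite eintS//; have := eint_ge0 x.
by case: (eint x) => // _; rewrite gt0_muley// lte_fin.
Qed.

Let eint_gt0 x : 1 <= x -> (0 < eint x)%E.
Proof.
move=> x1; apply: (@lt_le_trans _ _ (\int[mu]_(t in `[1%R, 2%R]) (expR (-2))%:E)%E).
  rewrite integral_cst//= lebesgue_measure_itv/= lte_fin ltr1n -EFinB -EFinM.
  by rewrite lte_fin mulr_gt0 ?expR_gt0// subr_gt0 ltr1n.
apply: (@le_trans _ _ (\int[mu]_(t in `[1%R, 2%R]) (euler_integrand x t)%:E)%E).
  apply: ge0_le_integral => //=.
  - exact: measurable_euler_integrand.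
  - move=> t; rewrite in_itv/= => /andP[t1 t2]; rewrite lee_fin.
    rewrite /euler_integrand -[leLHS]mul1r ler_pM ?expR_ge0//.
      by rewrite -[leLHS](powRr0 t) ler_powR// subr_ge0.
    by rewrite ler_expR lerN2.
apply: ge0_subset_integral => //=.
- exact: measurable_euler_integrand.
- by move=> t _; rewrite lee_fin.
- by move=> t /=; rewrite !in_itv/= andbT => /andP[t1 _]; exact: lt_le_trans t1.
Qed.

Lemma euler_integral_gt0 x : 0 < x -> 0 < euler_integral x.
Proof.
move=> x0; apply: fine_gt0; rewrite ltey_eq eint_fin// andbT.
(* Positivity is known at [x + 1 >= 1] and is carried back to [x]. *)
have : (0 < x%:E * eint x)%E by rewrite -eintS// eint_gt0// lerDr ltW.
by rewrite pmule_rgt0// lte_fin.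
Qed.

Lemma euler_integralS x : 0 < x -> euler_integral (x + 1) = x * euler_integral x.
Proof.
move=> x0; rewrite /euler_integral /Rintegral -/(eint (x + 1)) -/(eint x).
by rewrite eintS// fineM// eint_fin.
Qed.

Lemma euler_integral1 : euler_integral (1 : R) = 1.
Proof. by rewrite /euler_integral /Rintegral -/(eint 1) eint1. Qed.

End euler_integral.

(** * The Gamma function and the Taylor monomials *)

Section Gamma.
Context {R : realType}.
Implicit Types x : R.

Lemma Gamma_gt0E x : 0 < x -> Gamma x = euler_integral x.
Proof.
move=> x0; rewrite /Gamma (_ : Num.truncn (1 - x) = 0%N).
  by rewrite big_ord0 addr0 divr1.
by apply/eqP; rewrite -leqn0 truncn_le_nat ltrBlDr ltrDl.
Qed.

Lemma Gamma1 : Gamma (1 : R) = 1.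
Proof. by rewrite Gamma_gt0E ?euler_integral1. Qed.

(** Negative [x] are included because the entries of [matL] below the diagonal involve
    [Gamma (- nu)]; on [(-1, 0)] the definition of [Gamma] performs exactly one division, by [x]. *)
Lemma GammaS x : -1 < x -> x != 0 -> Gamma (x + 1) = x * Gamma x.
Proof.
move=> x1; rewrite neq_lt => /orP[x0|x0].
  rewrite Gamma_gt0E; last by rewrite -ltrBlDr sub0r.
  rewrite /Gamma (_ : Num.truncn (1 - x) = 1%N); last first.
    by apply/eqP; rewrite truncn_eq; lra.
  by rewrite big_ord1 addr0 mulrC divfK// lt_eqF.
by rewrite !Gamma_gt0E ?euler_integralS ?addr_gt0.
Qed.

Lemma Gamma_neq0 x : -1 < x -> x != 0 -> Gamma x != 0.
Proof.
move=> x1 x0; suff : x * Gamma x != 0 by rewrite mulf_eq0 negb_or => /andP[].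
have x2 : 0 < x + 1 by rewrite -ltrBlDr sub0r.
by rewrite -GammaS// Gamma_gt0E// gt_eqF// euler_integral_gt0.
Qed.

Lemma Gamma_add_nat x n : -1 < x -> x != 0 ->
  Gamma (x + n%:R) = Gamma x * \prod_(i < n) (x + i%:R).
Proof.
move=> x1 x0; elim: n => [|n IHn]; first by rewrite big_ord0 addr0 mulr1.
rewrite -natr1 addrA GammaS.
- by rewrite IHn big_ord_recr/= mulrC mulrA.
- by rewrite (lt_le_trans x1)// lerDl.
- case: n {IHn} => [|n]; first by rewrite addr0.
  by rewrite gt_eqF// -natr1 addrCA ltr_wpDl//; lra.
Qed.

Lemma Gamma_fact n : Gamma (n.+1%:R : R) = n`!%:R.
Proof.
rewrite -add1n natrD Gamma_add_nat ?oner_eq0//; last first.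
  by rewrite (lt_trans _ ltr01)// ltrN10.
rewrite Gamma1 mul1r fact_prod natr_prod big_add1 big_mkord.
by apply: eq_bigr => i _; rewrite -natrD.
Qed.

(** The numerator is [Gamma (mu + 1 + n)], so [Gamma (mu + 1)] cancels and a rising product over
    [n!] remains. The range of [mu] reaches [- nu - 1]. *)
Lemma taylor_monomialE (mu t a : R) (n : nat) :
  -1 < mu + 1 -> mu + 1 != 0 -> t - a = n.+1%:R ->
  taylor_monomial mu t a = rising_coef (mu + 1) n.
Proof.
move=> mu1 mu0 ta; rewrite /taylor_monomial ta Gamma_fact.
have n0 : n`!%:R != 0 :> R by rewrite pnatr_eq0 -lt0n fact_gt0.
rewrite -natr1 -addrA (addrC 1) addrC Gamma_add_nat//.
have -> : rising_coef (mu + 1) n = \prod_(i < n) (mu + 1 + i%:R) / n`!%:R.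
  rewrite /rising_coef big_split/= prodfV fact_prod natr_prod.
  by rewrite big_add1 big_mkord.
by field; rewrite n0 Gamma_neq0.
Qed.
End Gamma.

(** * The initial value problem, its series solution and its matrix form *)

Section exponential.
Context {R : realType} (nu lambda : R).

Lemma caputoE (u : nat -> R) (n : nat) : 0 < nu -> nu < 1 ->
  caputo nu u n.+1 =
  \sum_(s < n.+1) rising_coef (1 - nu) (n - s) * (u s.+1 - u s).
Proof.
move=> nu0 nu1.
rewrite /caputo /nabla_sum big_add1/= big_mkord; apply: eq_bigr => s _.
rewrite /nabla/=; congr (_ * _).
(* The summand sits at [s + 1], and [n + 1 - rho (s + 1) = (n - s) + 1]. *)
rewrite (@taylor_monomialE _ _ _ _ (n - s)).
- by rewrite subrK.
- by rewrite subrK; lra.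
- by rewrite subrK gt_eqF//; lra.
- have s_le : (s <= n)%N by rewrite -ltnS.
  by rewrite /rho -(natr1 s) addrK -natrB ?subSn// leqW.
Qed.

(** Moving the difference from [u] to the kernel lowers its parameter from [1 - nu] to [- nu] by
    Pascal's rule. *)
Lemma caputo_by_parts (u : nat -> R) (n : nat) : 0 < nu -> nu < 1 ->
  caputo nu u n.+1 =
  \sum_(s < n.+1) rising_coef (- nu) (n - s) * u s.+1
  - rising_coef (1 - nu) n * u 0%N.
Proof.
move=> nu0 nu1.
rewrite caputoE//; under eq_bigr do rewrite mulrBr.
rewrite sumrB [X in _ - X]big_ord_recl/= subn0 opprD addrA addrAC.
congr (_ - _).
rewrite big_ord_recr [in RHS]big_ord_recr/= subnn !rising_coef0 addrAC.
congr (_ + _); rewrite -sumrB; apply: eq_bigr => s _.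
rewrite /bump/= add1n -mulrBl subnS; congr (_ * _).
have : (0 < n - s)%N by rewrite subn_gt0.
case: (n - s)%N => // k _.
by rewrite rising_coef_pascal addrK addrAC subrr add0r.
Qed.

Lemma caputo_ivpP (u : nat -> R) : 0 < nu -> nu < 1 ->
  caputo_ivp nu lambda u <->
  u 0%N = 1 /\ forall n, \sum_(s < n.+1) rising_coef (- nu) (n - s) * u s.+1
    = rising_coef (1 - nu) n + lambda * u n.+1.
Proof.
move=> nu0 nu1.
split=> [[eu u0]|[u0 eu]]; split=> // n.
  by have := eu n.+1 isT; rewrite caputo_by_parts// u0 mulr1 => <-; ring.
case: n => // n _; rewrite caputo_by_parts// eu u0; ring.
Qed.

Lemma caputo_ivp_unique (u v : nat -> R) : 0 < nu -> nu < 1 -> `|lambda| < 1 ->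
  caputo_ivp nu lambda u -> caputo_ivp nu lambda v -> u = v.
Proof.
move=> nu0 nu1 lambda1 /(caputo_ivpP _ nu0 nu1)[u0 eu].
move=> /(caputo_ivpP _ nu0 nu1)[v0 ev]; apply/funext.
have l0 : 1 - lambda != 0.
  by rewrite subr_eq0 gt_eqF// (le_lt_trans (ler_norm _)).
elim/ltn_ind => -[_|n IHn]; first by rewrite u0 v0.
have := eu n; have := ev n.
(* The top term has coefficient 1, so the new value is determined through the factor [1 - lambda];
   the earlier terms agree by induction. *)
rewrite !big_ord_recr/= subnn rising_coef0 !mul1r.
rewrite [X in X + _ = _ -> _ -> _](eq_bigr
  (fun s : 'I_n => rising_coef (- nu) (n - s) * u s.+1)); last first.
  by move=> s _; rewrite IHn// ltnS.
move=> hv hu; apply: (mulfI l0).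
set s := \sum_(i < n) _ in hv hu; set c := rising_coef _ _ in hv hu.
by rewrite !mulrBl !mul1r; lra.
Qed.

(* lambda-free terms of the series, extended to t = 0 by H_0(0, 0) = 1 and
   H_(nu k)(0, 0) = 0 for k > 0. *)
Let monomial (k t : nat) : R :=
  if t is n.+1 then rising_coef (nu * k%:R + 1) n else (k == 0)%:R.

(** The increments are the coefficients with parameter [nu (k + 1)], the first one thanks to the
    value 0 at [t = 0]; convolving with the kernel [1 - nu] yields [nu k + 1]. *)
Let caputo_monomial k n : 0 < nu -> nu < 1 ->
  caputo nu (monomial k.+1) n.+1 = monomial k n.+1.
Proof.
move=> nu0 nu1.
rewrite caputoE//= (_ : nu * k%:R + 1 = nu * k.+1%:R + (1 - nu)); last first.
  by rewrite -natr1; ring.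
rewrite -rising_coef_vandermonde; apply: eq_bigr => -[[|s] ?] _ /=.
  by rewrite !rising_coef0 subr0 mulrC.
by rewrite (rising_coef_pascal (_ + 1)) addrK addrK mulrC.
Qed.

Let caputo_monomial0 n : 0 < nu -> nu < 1 -> caputo nu (monomial 0) n.+1 = 0.
Proof.
move=> nu0 nu1.
rewrite caputoE// big1// => -[[|s] ?] _ /=; rewrite mulr0 add0r !rising_coef_at1.
  by rewrite subrr mulr0.
by rewrite subrr mulr0.
Qed.

Let partial_exp (t : nat) := series (fun k => lambda ^+ k * monomial k t).

Lemma nabla_exp_termE t : 0 < nu -> (1 <= t)%N ->
  nabla_exp_term nu lambda t =
    fun k => lambda ^+ k * rising_coef (nu * k%:R + 1) t.-1.
Proof.
move=> nu0.
case: t => // n _; apply/funext => k; rewrite /nabla_exp_term.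
have h : 0 <= nu * k%:R by rewrite mulr_ge0// ltW.
by rewrite (@taylor_monomialE _ _ _ _ n) ?subr0// ?gt_eqF//; lra.
Qed.

Lemma is_cvg_nabla_exp t : 0 < nu -> nu < 1 -> `|lambda| < 1 -> (1 <= t)%N ->
  cvgn (series (nabla_exp_term nu lambda t)).
Proof.
move=> nu0 nu1 lambda1 t0; rewrite nabla_exp_termE//.
by apply: is_cvg_rising_coef_series => //; exact: ltW.
Qed.

Let cvg_partial_exp t : 0 < nu -> nu < 1 -> `|lambda| < 1 ->
  partial_exp t @ \oo --> nabla_exp nu lambda t.
Proof.
move=> nu0 nu1 lambda1.
case: t => [|n].
  (* At [t = 0] every nonempty partial sum equals 1; the shift skips the empty one. *)
  rewrite /nabla_exp/= -(cvg_shiftS _); apply: cvg_near_cst; near=> N.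
  rewrite /partial_exp /series/= big_mkord big_ord_recl/= expr0 mul1r.
  by rewrite big1 ?addr0// => i _; rewrite mulr0.
have := is_cvg_nabla_exp n.+1 nu0 nu1 lambda1 isT.
by rewrite /nabla_exp/= nabla_exp_termE.
Unshelve. all: end_near. Qed.

(** The constant term is annihilated and the others move down one degree, hence [N + 1] terms on the
    left and [N] on the right. *)
Let caputo_partial_exp n N : 0 < nu -> nu < 1 ->
  caputo nu (partial_exp ^~ N.+1) n.+1 = lambda * partial_exp n.+1 N.
Proof.
move=> nu0 nu1.
transitivity (\sum_(k < N.+1) lambda ^+ k * caputo nu (monomial k) n.+1).
  rewrite caputoE//; under [RHS]eq_bigr do rewrite caputoE// mulr_sumr.
  rewrite exchange_big/=; apply: eq_bigr => s _.
  rewrite /partial_exp /series/= !big_mkord -sumrB mulr_sumr.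
  by apply: eq_bigr => k _; rewrite -mulrBr mulrCA.
rewrite big_ord_recl caputo_monomial0// mulr0 add0r.
rewrite /partial_exp /series/= big_mkord mulr_sumr.
by apply: eq_bigr => k _; rewrite caputo_monomial// exprS mulrA.
Qed.

(** At a fixed time the Caputo difference is a finite sum, so it commutes with the limit of the
    partial sums. *)
Lemma nabla_exp_ivp : 0 < nu -> nu < 1 -> `|lambda| < 1 ->
  caputo_ivp nu lambda (nabla_exp nu lambda).
Proof.
move=> nu0 nu1 lambda1.
split=> // -[//|n] _.
have h1 : caputo nu (partial_exp ^~ N.+1) n.+1 @[N --> \oo] -->
    lambda * nabla_exp nu lambda n.+1.
  under eq_fun do rewrite caputo_partial_exp//.
  by apply: cvgMl_tmp; exact: cvg_partial_exp.
have h2 : caputo nu (partial_exp ^~ N.+1) n.+1 @[N --> \oo] -->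
    caputo nu (nabla_exp nu lambda) n.+1.
  under eq_fun do rewrite caputoE//; rewrite caputoE//.
  apply: cvg_big => [|s _]; first exact: add_continuous.
  apply: cvgMl_tmp; apply: cvgB.
    by rewrite (cvg_shiftS (partial_exp s.+1)); exact: cvg_partial_exp.
  by rewrite (cvg_shiftS (partial_exp s)); exact: cvg_partial_exp.
exact: (cvg_unique _ h2 h1).
Qed.

(** This exhibits [matL] as the Toeplitz matrix of convolution with the kernel [- nu], minus
    [lambda] times the identity. *)
Lemma matLE m (i j : 'I_m) : 0 < nu -> nu < 1 -> matL nu lambda m i j =
  (if (j <= i)%N then rising_coef (- nu) (i - j) else 0) - lambda *+ (i == j).
Proof.
move=> nu0 nu1.
rewrite mxE -val_eqE/=; case: (ltngtP i j) => [ij|ij|->].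
- by rewrite subr0.
- have -> : rising_coef (- nu) (i - j) = rising_coef (- nu - 1 + 1) (i - j)
    by rewrite subrK.
  rewrite subr0; apply: taylor_monomialE; rewrite ?subrK.
  + lra.
  + by rewrite lt_eqF//; lra.
  + by rewrite /rho -(natr1 j) addrK -natrB ?subSn ?(ltnW ij)// leqW// ltnW.
- by rewrite subnn rising_coef0.
Qed.

Lemma matL_unit m : `|lambda| < 1 -> matL nu lambda m \in unitmx.
Proof.
move=> lambda1.
rewrite unitmxE det_trig; last first.
  by apply/is_trig_mxP => i j ij; rewrite !mxE -val_eqE/= ij ltn_eqF.
rewrite unitfE; apply/prodf_neq0 => i _; rewrite mxE eqxx.
by rewrite subr_eq0 gt_eqF// (le_lt_trans (ler_norm _)).
Qed.

Lemma caputo_ivp_matL (u : nat -> R) m : 0 < nu -> nu < 1 ->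
  caputo_ivp nu lambda u ->
  matL nu lambda m *m \col_(i < m) u i.+1 = vecC nu m.
Proof.
move=> nu0 nu1 /(caputo_ivpP _ nu0 nu1)[_ eu]; apply/colP => i; rewrite !mxE.
rewrite (@taylor_monomialE _ _ _ _ i) ?subr0//; [|lra|by rewrite gt_eqF//; lra].
rewrite (addrC (- nu)); have /eqP := eu i; rewrite -subr_eq => /eqP <-.
under eq_bigr do rewrite matLE// mxE mulrBl.
rewrite sumrB; congr (_ - _).
  (* The convolution over [s <= i] is extended to all columns by the zeros above the diagonal. *)
  rewrite (big_ord_widen m (fun s => rising_coef (- nu) (i - s) * u s.+1))//.
  rewrite [RHS]big_mkcond/=; apply: eq_bigr => j _; rewrite ltnS.
  by case: ifP => //; rewrite mul0r.
rewrite (bigD1 i)//= eqxx mulr1n big1 ?addr0// => j ji.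
by rewrite eq_sym (negbTE ji) mul0r.
Qed.

End exponential.

(** Convergence is asserted because [limn] also has a value on divergent series; uniqueness
    identifies the sum with the exponential defined by the initial value problem. *)
Theorem mainTheorem2 (R : realType) (nu lambda : R) (m : nat)
    (hnu0 : 0 < nu) (hnu1 : nu < 1) (hlambda : `|lambda| < 1)
    (hm : (1 <= m)%N) :
  [/\ forall t : nat, (1 <= t)%N -> cvgn (series (nabla_exp_term nu lambda t)),
      unique (caputo_ivp nu lambda) (nabla_exp nu lambda),
      matL nu lambda m \in unitmx
    & \col_(i < m) nabla_exp nu lambda i.+1
        = invmx (matL nu lambda m) *m vecC nu m].
Proof.
have ivp := nabla_exp_ivp _ _ hnu0 hnu1 hlambda.
have Lu := matL_unit nu _ m hlambda.
split=> //.
- by move=> t; exact: is_cvg_nabla_exp.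
- by split=> // v; exact: (caputo_ivp_unique _ _ _ _ hnu0 hnu1 hlambda ivp).
- by rewrite -(caputo_ivp_matL _ _ _ m hnu0 hnu1 ivp) mulKmx.
Qed.
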